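(* Let $G$ be an Abelian group, let $(X,\mathcal{B},\mu)$ be a Lebesgue probability space, and let $\alpha: G\times X\to X$, $(g,x)\mapsto \alpha_g(x)$, be an action of $G$ on $X$ by measurable $\mu$-preserving transformations. Let $$Y=\{y\in X^{G}: y(tg)=\alpha_{t^{-1}}(y(g))\ \text{for all } t,g\in G\},$$ and let $\Pi_X:(Y,\overline{\mathcal{B}},\overline{\mu},G)\to(X,\mathcal{B},\mu,G)$, $\Pi_X(y)=y(e)$, be the natural extension of $(X,\mathcal{B},\mu,G)$, where $G$ acts on $Y$ by the restriction of the left shift $(sy)(t)=y(s^{-1}t)$, and $\overline{\mathcal{B}},\overline{\mu}$ are as defined in the context. Then the measure-theoretic $\overline{\mu}$-entropy of the $G$-action on $Y$ relative to $\Pi_X$ vanishes: $$h_{\overline{\mu}}(G,Y\mid\Pi_X)=0.$$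
   Context: **Lebesgue space.** A probability space is a Lebesgue space if it is isomorphic (mod null sets) to the disjoint union of an at most countable (possibly empty) set of points of positive measure and an interval $[0,s)$ (possibly absent) with the $\sigma$-algebra of Lebesgue measurable sets and Lebesgue measure, where $s=1-\sum_n p_n$ and $p_n$ are the masses of the points. **Action.** An action satisfies $\alpha_s(\alpha_t(x))=\alpha_{st}(x)$ and $\alpha_e(x)=x$ for all $s,t\in G$, $x\in X$, where $e$ is the identity of $G$. **Natural extension.** The set $Y\subseteq X^G$ defined in the claim is invariant under the left shift $(sy)(t)=y(s^{-1}t)$ (since $G$ is Abelian). For $g\in G$ let $\Pi_{g,X}:Y\to X$, $\Pi_{g,X}(y)=y(g)$, and $\Pi_X=\Pi_{e,X}$. Each $\Pi_{g,X}$ is surjective and $G$-equivariant. Put $\overline{\mathcal{B}}_g=\Pi_{g,X}^{-1}(\mathcal{B})=\{\Pi_{g,X}^{-1}(A):A\in\mathcal{B}\}$ and $\mathcal{D}_Y=\bigcup_{g\in G}\overline{\mathcal{B}}_g$, which is an algebra of subsets of $Y$. The measure $\overline{\mu}$ is determined by $\overline{\mu}(\Pi_{g,X}^{-1}(A))=\mu(A)$ for $A\in\mathcal{B}$, $g\in G$, and $\overline{\mathcal{B}}$ is the completion with respect to $\overline{\mu}$ of the $\sigma$-algebra generated by $\mathcal{D}_Y$. The shift action of $G$ on $(Y,\overline{\mathcal{B}},\overline{\mu})$ is measure-preserving, and $(Y,\overline{\mathcal{B}},\overline{\mu},G)$ together with the factor map $\Pi_X$ is called the natural extension of $(X,\mathcal{B},\mu,G)$.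 **Conditional entropy.** For a finite partition $\beta\subseteq\overline{\mathcal{B}}$ of $Y$ and a sub-$\sigma$-algebra $\mathcal{C}\subseteq\overline{\mathcal{B}}$, set $$H_{\overline{\mu}}(\beta\mid\mathcal{C})=-\sum_{B\in\beta}\int_Y \overline{\mu}(B\mid\mathcal{C})(y)\log\overline{\mu}(B\mid\mathcal{C})(y)\,d\overline{\mu}(y),$$ where $\overline{\mu}(B\mid\mathcal{C})$ is the conditional expectation of $1_B$ given $\mathcal{C}$ and $0\log 0=0$. For a finite nonempty $F\subseteq G$ put $\beta_F=\bigvee_{g\in F}g^{-1}\beta$, where $\bigvee$ denotes the join (common refinement). Entropy is computed along a Følner sequence $(F_n)_{n\in\mathbb{N}}$ of finite nonempty subsets of $G$. If $\mathcal{C}$ is $G$-invariant ($g^{-1}\mathcal{C}=\mathcal{C}$ up to null sets for all $g\in G$), set $$h_{\overline{\mu}}(G,\beta\mid\mathcal{C})=\lim_{n\to\infty}\frac{1}{|F_n|}H_{\overline{\mu}}(\beta_{F_n}\mid\mathcal{C}),\qquad h_{\overline{\mu}}(G,Y\mid\mathcal{C})=\sup_{\beta}h_{\overline{\mu}}(G,\beta\mid\mathcal{C}),$$ the supremum being over all finite partitions $\beta\subseteq\overline{\mathcal{B}}$ of $Y$. The entropy relative to $\Pi_X$ is $$h_{\overline{\mu}}(G,Y\mid\Pi_X)=h_{\overline{\mu}}(G,Y\mid\Pi_X^{-1}(\mathcal{B})).$$ *)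

(* Defs.v *)
From HB Require Import structures.
From mathcomp Require Import all_boot all_order all_algebra finmap.
From mathcomp Require Import all_classical all_reals all_analysis.
From mathcomp Require Import measurable_realfun.

Set Implicit Arguments.
Unset Strict Implicit.
Unset Printing Implicit Defensive.

Import Order.TTheory GRing.Theory Num.Theory.
Import numFieldNormedType.Exports.

Local Open Scope classical_set_scope.
Local Open Scope ring_scope.

(* Completion of a measure space: the measurable sets are the unions of a
   measurable and a negligible set; on these, the outer measure of [mu] is the
   unique measure extending [mu] (lemma [completion_extE]). *)

Section completion.
Local Open Scope ereal_scope.
Context d (T : measurableType d) (R : realType).
Variable mu : {measure set T -> \bar R}.

Definition completionType := g_sigma_algebraType (completed_algebra_gen mu).

Lemma sigma_algebra_completed_algebra_gen :
  sigma_algebra setT (completed_algebra_gen mu).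
Proof.
split.
- by exists set0 => //; exists set0; [exact: negligible_set0|rewrite setU0].
- move=> _ [A mA [N [M [mM M0 NM]] <-]]; rewrite setTD.
  exists (~` (A `|` M)); first by apply: measurableC; exact: measurableU.
  exists (M `&` ~` (A `|` N)).
    by exists M; split => // x [].
  apply/seteqP; split => [x [|[_ //]]|x Hx].
  + by apply: subsetC => y [Ay|Ny]; [left|right; exact: NM].
  + have [Mx|nMx] := pselect (M x); first by right.
    by left=> -[Ax|//]; apply: Hx; left.
- move=> F mF.
  pose A n := projT1 (cid2 (mF n)).
  pose N n := projT1 (cid2 (projT2 (cid2 (mF n))).2).
  exists (\bigcup_k A k).
    by apply: bigcupT_measurable => i; rewrite /A; case: cid2.
  exists (\bigcup_k N k).
    apply: negligible_bigcup => /= k.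
    by rewrite /N; case: (cid2 (mF k)) => //= *; case: cid2.
  rewrite -bigcupU; apply: eq_bigcup => // i _.
  by rewrite /A /N; case: (cid2 (mF i)) => //= *; case: cid2.
Qed.

Lemma measurable_completionE :
  (measurable : set (set completionType)) = completed_algebra_gen mu.
Proof.
exact: (measurable_g_measurableTypeE sigma_algebra_completed_algebra_gen).
Qed.

Definition completion : set completionType -> \bar R := (mu^*)%mu.

Lemma completion_sub_caratheodory (A : set completionType) :
  measurable A -> (mu^*)%mu.-cara.-measurable A.
Proof.
rewrite measurable_completionE => -[B mB [N [M [mM M0 NM]] <-]].
apply: measurableU; first exact: caratheodory_measurable_mu_ext.
apply: (@measure_is_complete_caratheodory _ _ (mu^*)%mu).
exists M; split => //; first exact: caratheodory_measurable_mu_ext.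
exact: etrans (measurable_mu_extE _ mM) M0.
Qed.

Lemma completion_extE (A N : set T) : measurable A -> mu.-negligible N ->
  completion (A `|` N) = mu A.
Proof.
move=> mA [M [mM M0 NM]]; apply/eqP; rewrite eq_le; apply/andP; split.
  rewrite -[leRHS]adde0 -M0 -(measurable_mu_extE _ mA) -(measurable_mu_extE _ mM).
  apply: le_trans (outer_measureU2 _ _ _).
  by apply: le_outer_measure; exact: setUS.
rewrite -(measurable_mu_extE _ mA).
by apply: (le_outer_measure (mu^*)%mu); exact: subsetUl.
Qed.

Let completion0 : completion set0 = 0. Proof. exact: mu_ext0. Qed.

Let completion_ge0 (A : set completionType) : 0 <= completion A.
Proof. exact: mu_ext_ge0. Qed.

Let completion_semi_sigma_additive : semi_sigma_additive completion.
Proof.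
move=> F mF tF mUF.
apply: (@caratheodory_measure_sigma_additive _ _ (mu^*)%mu) => //.
  by move=> i; exact: completion_sub_caratheodory (mF i).
exact: completion_sub_caratheodory mUF.
Qed.

HB.instance Definition _ := isMeasure.Build _ _ _ completion
  completion0 completion_ge0 completion_semi_sigma_additive.

End completion.
Arguments completion {d T R} mu.

Section completion_probability.
Context d (T : measurableType d) (R : realType).
Variable P : probability T R.

Let completion_setT : completion P setT = 1%E.
Proof.
rewrite -(setU0 setT) completion_extE//; first exact: probability_setT.
exact: negligible_set0.
Qed.

HB.instance Definition _ :=
  Measure_isProbability.Build _ _ _ (completion P) completion_setT.

End completion_probability.

(* Lebesgue spaces. The model is carried by [inl @` I `|` inr @` `[0, s[]
   inside [nat + R]: atoms [inl n] of mass [p n], and the interval [0, s) with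
   the Lebesgue sigma-algebra; isomorphism mod null sets is a bimeasurable
   measure-preserving bijection between conull measurable sets. *)

Section lebesgue_space.
Local Open Scope ereal_scope.
Context {R : realType}.

Definition model_carrier (I : set nat) (s : R) : set (nat + R) :=
  inl @` I `|` inr @` `[0%R, s[.

Definition model_measurable (A : set (nat + R)) :=
  completed_algebra_gen (@lebesgue_measure R) (inr @^-1` A).

Definition model_measure (p : nat -> R) (A : set (nat + R)) : \bar R :=
  \esum_(n in inl @^-1` A) (p n)%:E + completed_lebesgue_measure (inr @^-1` A).

Definition lebesgue_space d (X : measurableType d) (mu : probability X R) :=
  exists (I : set nat) (p : nat -> R) (s : R),
  [/\ (forall n, I n -> (0 < p n)%R),
      (0 <= s)%R,
      s%:E = 1 - \esum_(n in I) (p n)%:E &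
      exists (X0 : set X) (Z0 : set (nat + R)) (phi : X -> nat + R),
      [/\ measurable X0 /\ mu (~` X0) = 0,
          [/\ Z0 `<=` model_carrier I s, model_measurable Z0 &
              model_measure p (model_carrier I s `\` Z0) = 0],
          set_bij X0 Z0 phi,
          (forall A, A `<=` X0 ->
             measurable A <-> model_measurable (phi @` A)) &
          forall A, A `<=` X0 -> measurable A ->
             mu A = model_measure p (phi @` A)]].

End lebesgue_space.

(* Abelian groups are [zmodType]s, hence written additively. *)

Record mpaction (G : zmodType) d (X : measurableType d) (R : realType)
    (mu : probability X R) := MPAction {
  mpact :> G -> X -> X ;
  mpactD : forall s t x, mpact s (mpact t x) = mpact (s + t) x ;
  mpact0 : forall x, mpact 0 x = x ;
  measurable_mpact : forall g, measurable_fun setT (mpact g) ;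
  mpact_preserving : forall g A, measurable A -> mu (mpact g @^-1` A) = mu A
}.

Section natural_extension.
Context (G : zmodType) d (X : measurableType d) (R : realType).
Context (mu : probability X R).
Variable alpha : mpaction G mu.

Definition natext_set : set (G -> X) :=
  [set y | forall t g, y (t + g) = alpha (- t) (y g)].

Definition natext : Type := set_type natext_set.

Definition natext_proj (g : G) (y : natext) : X := val y g.

Fact natext_orbit_subproof (x : X) : (fun g => alpha (- g) x) \in natext_set.
Proof. by rewrite inE => t g /=; rewrite mpactD opprD. Qed.

Definition natext_orbit (x : X) : natext :=
  SigSub (natext_orbit_subproof x).

HB.instance Definition _ := Choice.on natext.
HB.instance Definition _ := isPointed.Build natext (natext_orbit point).

Fact natext_shift_subproof (s : G) (y : natext) :
  (fun t => val y (- s + t)) \in natext_set.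
Proof.
have /set_mem ymem := valP y.
by rewrite inE => t g /=; rewrite addrCA ymem.
Qed.

Definition natext_shift (s : G) (y : natext) : natext :=
  SigSub (natext_shift_subproof s y).

Definition natext_cylinders : set (set natext) :=
  \bigcup_(g in [set: G]) preimage_set_system setT (natext_proj g) measurable.

(* The sigma-algebra of X pulled back along the factor map [y |-> y(e)]. *)
Definition natext_factor : set (set natext) :=
  preimage_set_system setT (natext_proj 0) measurable.

(* The measure space generated by the cylinders, before completion. *)
Definition natextB : Type := g_sigma_algebraType natext_cylinders.
HB.instance Definition _ := Measurable.on natextB.

Definition natext_measure_spec (nu : set natextB -> \bar R) :=
  forall g A, measurable A -> nu (natext_proj g @^-1` A) = mu A.

End natural_extension.
Arguments natext_factor {G d X R mu} alpha.
Arguments natext_cylinders {G d X R mu} alpha.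
Arguments natext_shift {G d X R mu} alpha.

Section natext_measure_exists.
Context (G : zmodType) d (X : measurableType d) (R : realType).
Context (mu : probability X R) (alpha : mpaction G mu).

Lemma measurable_natext_orbit :
  measurable_fun setT (natext_orbit alpha : X -> natextB alpha).
Proof.
apply: (@measurability _ _ X (natextB alpha) setT _ (natext_cylinders alpha))
  => //.
move=> _ [_ [g _ [A mA <-]] <-]; rewrite !setTI.
by have := measurable_mpact alpha (- g) measurableT mA; rewrite setTI.
Qed.

Lemma natext_measure_exists :
  exists nu : probability (natextB alpha) R, natext_measure_spec nu.
Proof.
pose orb : {mfun X >-> natextB alpha} :=
  HB.pack (natext_orbit alpha : X -> natextB alpha)
    (isMeasurableFun.Build _ _ _ _ _ measurable_natext_orbit).
exists (distribution mu orb) => g A mA.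
exact: (mpact_preserving alpha (- g) mA).
Qed.

End natext_measure_exists.

Section conditional_entropy.
Local Open Scope ereal_scope.
Context d (T : measurableType d) (R : realType).
Variable P : probability T R.

Definition is_cond_exp (C : set (set T)) (f h : T -> R) :=
  [/\ measurable_fun setT (h : g_sigma_algebraType C -> R),
      P.-integrable setT (EFin \o h) &
      forall A, C A -> \int[P]_(x in A) (h x)%:E = \int[P]_(x in A) (f x)%:E].

(* The default [cst 0] is not reached when [C] is a sub-sigma-algebra and [f]
   is integrable, see [cond_expP]. *)
Definition cond_exp (C : set (set T)) (f : T -> R) : T -> R :=
  xget (cst 0%R) (is_cond_exp C f).

Lemma cond_expP (C : set (set T)) (f : T -> R) :
  sigma_algebra setT C -> C `<=` measurable -> P.-integrable setT (EFin \o f) ->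
  is_cond_exp C f (cond_exp C f).
Proof.
move=> sC Cm intf; rewrite /cond_exp; case: xgetP => [h -> //|noh]; exfalso.
have CE : C.-sigma.-measurable = C by exact: measurable_g_measurableTypeE.
have CEm A : (measurable : set (set (g_sigma_algebraType C))) A ->
    d.-measurable A.
  by move=> mA; have := mA; rewrite CE; exact: Cm.
have mid : measurable_fun setT (id : T -> g_sigma_algebraType C).
  by move=> _ A; rewrite CE setTI => /Cm.
pose X : {mfun T >-> g_sigma_algebraType C} :=
  HB.pack (id : T -> g_sigma_algebraType C) (isMeasurableFun.Build _ _ _ _ _ mid).
pose PC : probability (g_sigma_algebraType C) R := distribution P X.
pose ch : {charge set T -> \bar R} := induced_charge intf.
pose nuX : {charge set (g_sigma_algebraType C) -> \bar R} :=
  pushforward ch X.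
pose nu := nuX mid.
have numu : nu `<< PC.
  apply/null_content_dominatesP => A mA PA0.
  apply: null_set_integral => //.
  - exact: CEm.
  - by case/integrableP : (intf) => + _; exact: measurable_funTS.
have [h [hfin inth hE]] := charge.Radon_Nikodym0 numu.
have mh : measurable_fun setT h by exact: measurable_int inth.
have hK : EFin \o (fine \o h) = h by apply/funext => x /=; rewrite fineK.
have inthP : P.-integrable setT h.
  apply/integrableP; split; first exact: (measurableT_comp mh mid).
  case/integrableP : (inth) => _; apply: le_lt_trans.
  rewrite [leRHS](ge0_integral_pushforward mid)//.
  exact: measurableT_comp.
apply: (noh (fine \o h)); split.
- exact: measurableT_comp.
- by rewrite hK.
- move=> A CA.
  have mA : measurable (A : set (g_sigma_algebraType C)) by rewrite CE.
  transitivity (\int[P]_(x in A) h x).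
    by apply: eq_integral => x _; rewrite /= fineK.
  have := hE _ mA; rewrite [X in _ = X -> _](integral_pushforward mid)//.
  by apply: integrableS inthP => //; exact: Cm.
Qed.

Definition cond_prob (C : set (set T)) (B : set T) : T -> R :=
  cond_exp C \1_B.

Definition finite_partition (beta : set (set T)) :=
  [/\ finite_set beta, beta `<=` measurable & partition beta id setT].

(* The convention 0 log 0 = 0 is automatic, [ln] being total. *)
Definition cond_entropy (beta C : set (set T)) : \bar R :=
  - \sum_(B \in beta)
      \int[P]_y (cond_prob C B y * ln (cond_prob C B y))%:E.

Definition join (beta gamma : set (set T)) : set (set T) :=
  [set B `&` B' | B in beta & B' in gamma] `\ set0.

Section along_action.
Context (G : zmodType) (a : G -> T -> T).

Definition join_over (F : {fset G}) (beta : set (set T)) : set (set T) :=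
  \big[join/[set setT]]_(g <- F) [set a g @^-1` B | B in beta].

Definition mean_entropy (F : nat -> {fset G}) (beta C : set (set T)) (n : nat)
    : \bar R :=
  ((#|` F n|%fset%:R)^-1)%:E * cond_entropy (join_over (F n) beta) C.

(* [limn] returns a default value on a divergent sequence: a claim about this
   limit is meaningful only together with [cvgn (mean_entropy F beta C)]. *)
Definition entropy_partition (F : nat -> {fset G}) (beta C : set (set T)) :=
  limn (mean_entropy F beta C).

Definition entropy (F : nat -> {fset G}) (C : set (set T)) : \bar R :=
  ereal_sup [set entropy_partition F beta C | beta in finite_partition].

End along_action.

End conditional_entropy.

Definition folner (R : realType) (G : zmodType) (F : nat -> {fset G}) :=
  (forall n, F n != fset0) /\
  forall g, (fun n => let gF := [fset (g + x)%R | x in F n]%fset in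
    #|` ((gF `\` F n) `|` (F n `\` gF))|%fset%:R / #|` F n|%fset%:R : R)
    @ \oo --> (0 : R).

(* Main.v *)
Require Import Defs.
From HB Require Import structures.
From mathcomp Require Import all_boot all_order all_algebra finmap.
From mathcomp Require Import all_classical all_reals all_analysis.
From mathcomp Require Import measurable_realfun.

(** A point [y] of [Y] is determined by [y(e)], and [y(g)] is the image of
    [y(e)] under a transformation of the action; so every cylinder already
    belongs to the factor sigma-algebra, which therefore contains every
    measurable set up to a null set. The conditional probability of a
    measurable set is then almost everywhere its indicator, for which
    [p log p] vanishes. *)

Local Open Scope classical_set_scope.
Local Open Scope ring_scope.

Import Order.TTheory GRing.Theory Num.Theory.

Section cond_entropy_exhausting.
Context d (T : measurableType d) (R : realType) (P : probability T R).
Variable C : set (set T).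
Hypothesis sC : sigma_algebra setT C.
Hypothesis Cm : C `<=` measurable.
Hypothesis mC :
  measurable `<=` [set A `|` N | A in C & N in P.-negligible].

(** Integrals over measurable sets determine an integrable function almost everywhere. By [mC] each
    such set differs from a member of [C] by a null set, and over members of [C] the two integrals
    agree by definition of conditional expectation. *)
Lemma cond_prob_ae_indic (B : set T) : measurable B ->
  ae_eq P setT (EFin \o cond_prob P C B) (EFin \o \1_B).
Proof.
move=> mB; have iB : P.-integrable setT (EFin \o \1_B).
  exact: integrable_indic.
have [_ ih hE] := cond_expP sC Cm iB.
apply: (integral_ae_eq measurableT ih); first by case/integrableP: iB.
move=> E _ mE; have [A CA [N [M [mM M0 NM]] AN]] := mC _ mE.
have mA := Cm _ CA.
(* Removing the null set [M] changes neither integral, and [E] and [A] coincide outside [M] because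
   [N] lies in [M]. *)
have negl f : P.-integrable setT f ->
    (\int[P]_(x in E) f x = \int[P]_(x in A) f x)%E.
  move=> intf.
  rewrite (negligible_integral mM mE (integrableS _ _ _ intf) M0)//.
  rewrite (negligible_integral mM mA (integrableS _ _ _ intf) M0)//.
  congr (integral _ _ _); rewrite -AN setDUl.
  by rewrite (_ : N `\` M = set0) ?setU0// setD_eq0.
rewrite negl// [RHS]negl//.
exact: hE.
Qed.

Lemma cond_entropy_exhausting (beta : set (set T)) :
  beta `<=` measurable -> cond_entropy P beta C = 0%E.
Proof.
move=> mbeta; rewrite /cond_entropy fsbig1 ?oppe0// => B /mbeta mB.
have iB : P.-integrable setT (EFin \o \1_B) by exact: integrable_indic.
have [_ ih _] := cond_expP sC Cm iB.
have mh : measurable_fun setT (cond_prob P C B).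
  by apply/measurable_EFinP; exact: measurable_int ih.
rewrite (ae_eq_integral (cst 0%E)) ?integral0//.
  apply/measurable_EFinP; apply: measurable_funM => //.
  exact: measurableT_comp.
apply: filterS (cond_prob_ae_indic _ mB) => x /(_ I) [hx] _.
(* At the value 1 the logarithm vanishes; at the value 0 the factor in front of it does, whatever
   [ln 0] is. *)
by rewrite hx indicE; case: (x \in B); rewrite ?ln1 ?mulr0 ?mul0r.
Qed.

End cond_entropy_exhausting.

Lemma measurable_join_over d (T : measurableType d) (G : zmodType)
    (a : G -> T -> T) (F : {fset G}) (beta : set (set T)) :
  (forall g, measurable_fun setT (a g)) -> beta `<=` measurable ->
  join_over a F beta `<=` measurable.
Proof.
move=> ma mbeta.
pose K (gamma : set (set T)) := gamma `<=` measurable.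
apply: (big_ind K).
- by move=> _ ->; exact: measurableT.
- move=> b c mb mc _ [[B bB [B' cB' <-]] _].
  by apply: measurableI; [exact: mb|exact: mc].
- move=> g _ _ [B bB <-]; rewrite -[X in measurable X]setTI.
  by apply: ma => //; exact: mbeta.
Qed.

Section natural_extension.
Context (G : zmodType) d (X : measurableType d) (R : realType).
Context (mu : probability X R) (alpha : mpaction G mu).

Lemma natext_projE g (y : natext alpha) :
  natext_proj g y = alpha (- g) (natext_proj 0 y).
Proof. by have /set_mem/(_ g 0) := valP y; rewrite addr0. Qed.

Lemma natext_proj_shift s (y : natext alpha) :
  natext_proj 0 (natext_shift alpha s y) = alpha s (natext_proj 0 y).
Proof.
(* The shifted point takes at 0 the value of [y] at [- s], so [natext_projE] is used at [- s]. *)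
by rewrite -[s in RHS]opprK -natext_projE /natext_proj /= addr0.
Qed.

Lemma sigma_algebra_natext_factor : sigma_algebra setT (natext_factor alpha).
Proof.
apply: sigma_algebra_preimage; exact: sigma_algebra_measurable.
Qed.

Lemma measurable_natextBE :
  (measurable : set (set (natextB alpha))) = natext_factor alpha.
Proof.
apply/seteqP; split.
  apply: smallest_sub; first exact: sigma_algebra_natext_factor.
  move=> _ [g _ [A mA <-]]; exists (alpha (- g) @^-1` A).
    rewrite -[X in measurable X]setTI.
    exact: (measurable_mpact alpha (- g)).
  by rewrite !setTI; apply/seteqP; split => y /=; rewrite (natext_projE g).
by move=> A fA; apply: sub_sigma_algebra; exists 0.
Qed.

Context (nu : probability (natextB alpha) R) (hnu : natext_measure_spec nu).

(** The evaluation at 0 intertwines the shift by [s] with [alpha s], so invariance of the factor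
    sigma-algebra and of the measure are both inherited from the action on [X]. *)
Lemma natext_shift_factor s (A : set (natext alpha)) :
  natext_factor alpha A -> natext_factor alpha (natext_shift alpha s @^-1` A) /\
  nu (natext_shift alpha s @^-1` A) = nu A.
Proof.
move=> [B mB <-]; rewrite !setTI.
have mB' : measurable (alpha s @^-1` B).
  by rewrite -[X in measurable X]setTI; exact: (measurable_mpact alpha s).
have -> : natext_shift alpha s @^-1` (natext_proj 0 @^-1` B) =
    natext_proj 0 @^-1` (alpha s @^-1` B).
  by apply/seteqP; split => y /=; rewrite natext_proj_shift.
split; first by exists (alpha s @^-1` B) => //; rewrite setTI.
by rewrite !hnu// mpact_preserving.
Qed.

(** On the completion, null sets must also pull back to null sets. The null cover [M] lies in the
    factor sigma-algebra, where the shift preserves [nu]. *)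
Lemma measurable_natext_shift s :
  measurable_fun setT
    (natext_shift alpha s : completionType nu -> completionType nu).
Proof.
move=> _ B; rewrite setTI measurable_completionE.
move=> -[A mA [N [M [mM M0 NM]] <-]].
move: mA mM; rewrite measurable_natextBE => fA fM.
exists (natext_shift alpha s @^-1` A).
  by rewrite measurable_natextBE; exact: (natext_shift_factor s _ fA).1.
exists (natext_shift alpha s @^-1` N) => //.
exists (natext_shift alpha s @^-1` M); split.
- by rewrite measurable_natextBE; exact: (natext_shift_factor s _ fM).1.
- exact: etrans (natext_shift_factor s _ fM).2 M0.
- by move=> y; exact: NM.
Qed.

Lemma natext_factor_measurable :
  natext_factor alpha `<=` (measurable : set (set (completionType nu))).
Proof.
move=> A fA; rewrite measurable_completionE.
exists A; first by rewrite measurable_natextBE.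
by exists set0; [exact: negligible_set0|rewrite setU0].
Qed.

Lemma natext_factor_exhausting :
  (measurable : set (set (completionType nu))) `<=`
  [set A `|` N | A in natext_factor alpha & N in (completion nu).-negligible].
Proof.
move=> B; rewrite measurable_completionE => -[A mA [N [M [mM M0 NM]] <-]].
exists A; first by rewrite -measurable_natextBE.
exists N => //; exists M; split => //.
  by apply: natext_factor_measurable; rewrite -measurable_natextBE.
(* [M] has to be null for the completed measure; writing it as [M] joined with the empty set gives
   it the form required by [completion_extE]. *)
rewrite -(setU0 M) -M0; apply: completion_extE => //.
exact: negligible_set0.
Qed.

Lemma mean_entropy_natext (F : nat -> {fset G})
    (beta : set (set (completionType nu))) : beta `<=` measurable ->
  mean_entropy (completion nu) (natext_shift alpha) F beta
    (natext_factor alpha) = cst 0%E.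
Proof.
move=> mbeta; apply/funext => n; rewrite /mean_entropy.
rewrite cond_entropy_exhausting ?mule0//.
- exact: sigma_algebra_natext_factor.
- exact: natext_factor_measurable.
- exact: natext_factor_exhausting.
- by apply: measurable_join_over => // g; exact: measurable_natext_shift.
Qed.

End natural_extension.

(** The supremum defining [entropy] needs at least one partition, since the supremum of the empty
    set is minus infinity. The single block is nonempty because [T] is pointed. *)
Lemma finite_partition_setT d (T : measurableType d) :
  finite_partition [set [set: T]].
Proof.
split; first exact: finite_set1.
- by move=> _ ->; exact: measurableT.
- split; first by rewrite /cover bigcup_set1.
  + by move=> A B -> ->.
  + by move=> _ ->; exists point.
Qed.

Theorem theorem3p1 (R : realType) (G : zmodType)
    (F : nat -> {fset G}) (hF : folner R F)
    (d : measure_display) (X : measurableType d) (mu : probability X R)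
    (hX : lebesgue_space mu) (alpha : mpaction G mu)
    (nu : probability (natextB alpha) R) (hnu : natext_measure_spec nu) :
  (forall beta : set (set (completionType nu)), finite_partition beta ->
     cvgn (mean_entropy (completion nu) (natext_shift alpha) F beta
             (natext_factor alpha))) /\
  entropy (completion nu) (natext_shift alpha) F (natext_factor alpha) = 0%E.
Proof.
split=> [beta [_ mbeta _]|].
  by rewrite mean_entropy_natext//; exact: is_cvg_cst.
have lim0 beta : finite_partition beta ->
    entropy_partition (completion nu) (natext_shift alpha) F beta
      (natext_factor alpha) = 0%E.
  move=> [_ mbeta _].
  by rewrite /entropy_partition mean_entropy_natext//; exact: lim_cst.
(* The set of entropies over all finite partitions is exactly the singleton of 0; the trivial
   partition attains it. *)
rewrite /entropy -[RHS]ereal_sup1; congr ereal_sup.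
apply/seteqP; split=> [_ [beta pbeta <-]|_ ->]; first exact: lim0.
exists [set setT]; first exact: finite_partition_setT.
by apply: lim0; exact: finite_partition_setT.
Qed.
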